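(* Let $\kappa>1$, $c=\zeta(\kappa)=\sum_{n\in\mathbb N}n^{-\kappa}$, $a_0=0$, $a_n=\sum_{j=1}^n\frac1{cj^\kappa}$, $P_n=[a_{n-1},a_n)$ for $n\in\mathbb N$, and define $f$ by $f(x)=cn^\kappa(x-a_{n-1})$ for $x\in P_n$, $n\in\mathbb N$. Let $\omega>1$, let $\tilde\mu$ be the finite Bernoulli measure on $\mathbb N^{\mathbb N_0}$ given by $\tilde\mu([i_0,\dots,i_{n-1}])=\prod_{j=0}^{n-1}\omega^{-i_j}$, and let $\mu=\pi_*\tilde\mu$ be the push-forward measure, so that $\mu(P_n)=\omega^{-n}$. Then $\overline{\dim}_M(\mu)=\infty$, but $\dim_M^s(\mu)=\frac1{\kappa-1}$.
   Context: $\mathbb N=\{1,2,\dots\}$ and $\mathbb N_0=\mathbb N\cup\{0\}$. The map $f$ is an infinitely full-branched affine map, coded by the full shift on $\mathbb N$: $x=\pi(i_0,i_1,\dots)$ if $f^j(x)\in P_{i_j}$ for all $j\ge0$. $[i_0,\dots,i_{n-1}]$ is the set of sequences in $\mathbb N^{\mathbb N_0}$ beginning with $i_0,\dots,i_{n-1}$. $M_\mu(r):=\min_{x\in\mathrm{supp}(\mu)}\mu(B(x,r))$; the upper Minkowski dimension is $\overline{\dim}_M(\mu):=\limsup_{r\to0}\frac{\log M_\mu(r)}{\log r}$; the upper and lower stretched Minkowski dimensions are the $\limsup$ and $\liminf$ as $r\to0$ of $\frac{\log|\log M_\mu(r)|}{-\log r}$, and $\dim_M^s(\mu)$ denotes their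 common value when they coincide.
   Formalization: The cylinder formula ∏ω^{-i_j} is additive only for ω=2; it is replaced by C·∏(ω^{-i_j}/Z) with constants C,Z>0, which covers the printed formula (C=Z=1) and, for every ω>1, the measure with μ(P_n)=ω^{-n} (C=Z=1/(ω-1)). *)

(* Defs.v *)
From HB Require Import structures.
From mathcomp Require Import all_boot all_order all_algebra.
From mathcomp Require Import all_classical all_reals all_analysis.

Set Implicit Arguments.
Unset Strict Implicit.
Unset Printing Implicit Defensive.

Import Order.TTheory GRing.Theory Num.Theory.
Import numFieldNormedType.Exports.

Local Open Scope classical_set_scope.
Local Open Scope ring_scope.

(* The alphabet is {1, 2, ...}; it is encoded by nat, the letter k : nat
   standing for the positive integer k.+1. *)
Definition cylinder (s : seq nat) : set (nat -> nat) :=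
  [set i | forall j, (j < size s)%N -> i j = nth 0%N s j].

Definition cylinders : set (set (nat -> nat)) := range cylinder.

Definition shift_space := g_sigma_algebraType cylinders.

Section affine_map.
Context {R : realType}.
Variable kappa : R.

Definition zeta_kappa : R :=
  limn (fun N => \sum_(1 <= n < N) (n%:R `^ kappa)^-1).

Definition a (n : nat) : R :=
  \sum_(1 <= j < n.+1) (zeta_kappa * j%:R `^ kappa)^-1.

(* Only meant for n >= 1; P 0 is empty. *)
Definition P (n : nat) : set R := `[a n.-1, a n[.

(* On [0, 1[, the union of the disjoint intervals P n, n >= 1, branch x is the
   index of the interval containing x; the values of f elsewhere are
   irrelevant. *)
Definition branch (x : R) : nat := get [set n | (0 < n)%N /\ P n x].

Definition f (x : R) : R :=
  let n := branch x in zeta_kappa * n%:R `^ kappa * (x - a n.-1).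

(* Every sequence codes exactly one point: since the branches accumulate only
   at 1, which is not in [0, 1[, the closed cylinder intervals meet in a point
   that lies in all of the half-open ones. *)
Definition coding (i : shift_space) : R :=
  get [set x | forall j, P (i j).+1 (iter j f x)].

End affine_map.

(* The finite Bernoulli measures with weights omega ^- n, n >= 1, where the
   total mass and the weights may be normalised.  The formula
   nu [i_0, ..., i_(n-1)] = \prod_j omega ^- i_j is the case C = Z = 1; as the
   weights sum to (omega - 1)^-1, it is additive only if omega = 2, and in
   general additivity forces Z = (omega - 1)^-1.  Then C = Z gives
   nu [n] = omega ^- n and C = 1 gives the Bernoulli probability measure. *)
Definition finite_bernoulli {R : realType} (omega : R)
    (nu : set shift_space -> \bar R) : Prop :=
  exists C Z : R, [/\ 0 < C, 0 < Z &
    forall s : seq nat,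
      nu (cylinder s) = (C * \prod_(k <- s) (omega ^- k.+1 / Z))%:E].

Section dimensions.
Context {R : realType}.
Variable mu : set R -> \bar R.

Definition msupp : set R :=
  [set x | forall U : set R, open_nbhs x U -> (0 < mu U)%E].

(* For a finite measure on R with compact support, x |-> mu (ball x r) is lower
   semicontinuous, hence the infimum over the support is a minimum. *)
Definition M (r : R) : R :=
  fine (ereal_inf [set mu (ball x r) | x in msupp]).

Definition upper_minkowski_dim : \bar R :=
  limf_esup (fun r => (ln (M r) / ln r)%:E) (0 : R)^'+.

Definition stretched_ratio (r : R) : \bar R :=
  (ln `|ln (M r)| / - ln r)%:E.

Definition upper_stretched_minkowski_dim : \bar R :=
  limf_esup stretched_ratio (0 : R)^'+.

Definition lower_stretched_minkowski_dim : \bar R :=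
  limf_einf stretched_ratio (0 : R)^'+.

Definition has_stretched_minkowski_dim (d : \bar R) : Prop :=
  upper_stretched_minkowski_dim = d /\ lower_stretched_minkowski_dim = d.

End dimensions.

(* Main.v *)
(* Write s = 1 / (kappa - 1); then - ln (M mu r) is shown to lie between two
   constant multiples of r ^ - s, which gives both limits.  The ball of radius r
   about the accumulation point 1 of the branches meets only the P_n with
   1 - a_n < r, that is n >~ r ^ - s, whose total measure is of order
   omega ^ - n.  Conversely, let x be coded by i_0 i_1 ..., and let
   i_0 ... i_(n-1) be the longest prefix whose cylinder interval is longer than
   r.  The ball about x contains the cylinder of that prefix followed by
   min(i_n, N), with N ~ r ^ - s chosen so that 1 - a_N < r.  The last letter
   costs omega ^ - N, and the prefix costs at most exp (- B r ^ - s): a letter k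
   contracts by 1 / (c k ^ kappa), so the exponent - s of the contraction is at
   least c ^ s k, which pays for the additive cost k ln omega. *)
Require Import Defs.
From HB Require Import structures.
From mathcomp Require Import all_boot all_order all_algebra.
From mathcomp Require Import all_classical all_reals all_analysis.
From mathcomp Require Import ring lra.

Import Order.TTheory GRing.Theory Num.Theory.
Import numFieldNormedType.Exports.

Local Open Scope classical_set_scope.
Local Open Scope ring_scope.

(** * Tails of the zeta series and the endpoints [a n] *)

Section zeta_tails.
Context {R : realType} (kappa : R).
Hypothesis kappa_gt1 : 1 < kappa.

Let kappa_gt0 : 0 < kappa. Proof. exact: lt_trans kappa_gt1. Qed.

Let natR_gt0 (n : nat) : (0 < n)%N -> 0 < n%:R :> R.
Proof. by rewrite ltr0n. Qed.

(* Bernoulli's inequality for the exponent 1 - kappa < 0, which plays the role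
   of comparing the sum with the integral of x ^ - kappa. *)
Lemma inv_powR_le_diff (n : nat) : (0 < n)%N ->
  (n.+1%:R `^ kappa)^-1 <=
  (kappa - 1)^-1 * ((n%:R `^ (kappa - 1))^-1 - (n.+1%:R `^ (kappa - 1))^-1).
Proof.
move=> n0; have b0 : 0 < kappa - 1 by rewrite subr_gt0.
have m0 : 0 < n.+1%:R :> R by rewrite ltr0n.
have n0R := natR_gt0 n n0.
rewrite ler_pdivlMl//.
rewrite -(mulr_powRB1 (ltW m0) kappa_gt0).
(* With [u = 1 / n.+1] one has [n = n.+1 * (1 - u)]; what remains is [expR x >= 1 + x] combined with
   [ln (1 - u) <= - u]. *)
have -> : (n%:R `^ (kappa - 1))^-1 =
    (n.+1%:R `^ (kappa - 1))^-1 * expR (- (kappa - 1) * ln (1 + - n.+1%:R^-1)) :> R.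
  have -> : 1 + - n.+1%:R^-1 = n%:R / n.+1%:R :> R.
    by rewrite -natr1; field; rewrite natr1 gt_eqF.
  rewrite ln_div ?posrE// mulNr expRN mulrC mulrBr expRB.
  rewrite /powR !gt_eqF// invf_div; field.
  by rewrite !gt_eqF ?expR_gt0.
rewrite -[X in _ <= _ - X]mulr1 -mulrBr invfM mulrA mulrC.
rewrite ler_pM2l ?invr_gt0 ?powR_gt0//.
rewrite lerBrDl; apply: le_trans (expR_ge1Dx _).
rewrite lerD2l mulNr -mulrN ler_pM2l//.
rewrite lerNr; apply: le_ln1Dx.
by rewrite ltrN2 invf_lt1// ltr1n ltnS.
Qed.

Lemma sum_inv_powR_le (m n : nat) : (0 < m)%N -> (m <= n)%N ->
  \sum_(m.+1 <= j < n.+1) (j%:R `^ kappa)^-1 <=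
  ((kappa - 1) * m%:R `^ (kappa - 1))^-1.
Proof.
move=> m0 mn.
(* The induction needs the full telescoped difference; its negative term is dropped only
   afterwards. *)
suff : \sum_(m.+1 <= j < n.+1) (j%:R `^ kappa)^-1 <= (kappa - 1)^-1 *
    ((m%:R `^ (kappa - 1))^-1 - (n%:R `^ (kappa - 1))^-1).
  move=> /le_trans; apply; rewrite invfM ler_pM2l ?invr_gt0 ?subr_gt0//.
  by rewrite gerBl invr_ge0 powR_ge0.
elim: n mn => [|n IHn]; first by rewrite leqn0 => /eqP m00; rewrite m00 in m0.
rewrite leq_eqVlt => /predU1P[<-|]; first by rewrite big_geq// subrr mulr0.
rewrite ltnS => mn; rewrite big_nat_recr//=.
apply: (le_trans (lerD (IHn mn) (inv_powR_le_diff _ (leq_trans m0 mn)))).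
by rewrite -mulrDr addrA subrK.
Qed.

Let S (N : nat) : R := \sum_(1 <= n < N) (n%:R `^ kappa)^-1.

Let S_nondecreasing : nondecreasing_seq S.
Proof.
apply/nondecreasing_seqP => -[|n]; first by rewrite /S !big_geq.
by rewrite /S [leRHS]big_nat_recr//= lerDl invr_ge0 powR_ge0.
Qed.

Let S_split (m N : nat) : (m < N)%N ->
  S N = S m.+1 + \sum_(m.+1 <= j < N) (j%:R `^ kappa)^-1.
Proof. by move=> mN; rewrite /S (@big_cat_nat _ _ _ m.+1). Qed.

Let S_le (m N : nat) : (0 < m)%N ->
  S N <= S m.+1 + ((kappa - 1) * m%:R `^ (kappa - 1))^-1.
Proof.
move=> m0; case: (leqP N m.+1) => [Nm|].
  apply: (le_trans (S_nondecreasing _ _ Nm)).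
  by rewrite lerDl invr_ge0 mulr_ge0 ?powR_ge0// subr_ge0 ltW.
case: N => // N; rewrite ltnS => mN.
by rewrite (S_split m N.+1) ?lerD2l ?sum_inv_powR_le// 1?ltnW// ltnS ltnW.
Qed.

Let S_cvg : cvgn S.
Proof.
apply: nondecreasing_is_cvgn => //.
exists (S 2 + ((kappa - 1) * 1%:R `^ (kappa - 1))^-1) => _ [N _ <-].
exact: S_le.
Qed.

Let S_le_zeta (N : nat) : S N <= zeta_kappa kappa.
Proof. exact: nondecreasing_cvgn_le. Qed.

(** The terms for 1 and 2 suffice. Strictness makes the inverse branches uniform contractions, and
    gives [C > 1] in [expR_le_prod_letters]. *)
Lemma zeta_kappa_gt1 : 1 < zeta_kappa kappa.
Proof.
apply: lt_le_trans (S_le_zeta 3).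
rewrite /S big_nat_recr//= big_nat1 powR1 invr1 ltrDl invr_gt0.
by rewrite powR_gt0.
Qed.

Let zeta_gt0 : 0 < zeta_kappa kappa.
Proof. exact: lt_trans zeta_kappa_gt1. Qed.

(** Indexed by the letter [k], hence the length of [P k.+1]. *)
Definition width (k : nat) : R := (zeta_kappa kappa * k.+1%:R `^ kappa)^-1.

Lemma width_gt0 k : 0 < width k.
Proof. by rewrite invr_gt0 mulr_gt0// powR_gt0. Qed.

Lemma a0 : a kappa 0 = 0.
Proof. by rewrite /a big_geq. Qed.

Lemma aS k : a kappa k.+1 = a kappa k + width k.
Proof. by rewrite /a big_nat_recr. Qed.

Let a_S n : a kappa n = (zeta_kappa kappa)^-1 * S n.+1.
Proof. by rewrite /a /S mulr_sumr; apply: eq_bigr => j _; rewrite invfM. Qed.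

Lemma a_homo_lt : {homo a kappa : m n / (m < n)%N >-> m < n}.
Proof.
apply: homo_ltn => [m n p|k]; first exact: lt_trans.
by rewrite aS ltrDl width_gt0.
Qed.

Lemma a_homo_le : {homo a kappa : m n / (m <= n)%N >-> m <= n}.
Proof.
move=> m n; rewrite leq_eqVlt => /predU1P[->//|mn]; exact/ltW/a_homo_lt.
Qed.

Lemma a_ge0 n : 0 <= a kappa n.
Proof. by rewrite -a0 a_homo_le. Qed.

Lemma a_lt1 n : a kappa n < 1.
Proof.
apply: (lt_le_trans (a_homo_lt _ _ (ltnSn n))).
by rewrite a_S ler_pdivrMl// mulr1 S_le_zeta.
Qed.

Lemma a_tail_le (n : nat) : (0 < n)%N -> 1 - a kappa n <=
  (zeta_kappa kappa * (kappa - 1))^-1 * (n%:R `^ (kappa - 1))^-1.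
Proof.
move=> n0.
rewrite a_S [(zeta_kappa _ * _)^-1]invfM -mulrA -[in leLHS](mulVf (lt0r_neq0 zeta_gt0)).
rewrite -mulrBr ler_pM2l ?invr_gt0// lerBlDl -invfM.
by apply: limr_le => //; apply: nearW => N; exact: S_le.
Qed.

(* The n terms with indices in ]n, 2n] alone are that large. *)
Lemma a_tail_ge (n : nat) : (0 < n)%N ->
  (zeta_kappa kappa * 2 `^ kappa)^-1 * (n%:R `^ (kappa - 1))^-1 <=
  1 - a kappa n.
Proof.
move=> n0; have n0R := natR_gt0 n n0.
apply: le_trans (lerD (ltW (a_lt1 (n + n))) (lexx _)).
rewrite !a_S -mulrBr [(zeta_kappa _ * _)^-1]invfM -mulrA ler_pM2l ?invr_gt0//.
rewrite (S_split n (n + n).+1) ?ltnS ?leq_addr// addrAC subrr add0r.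
(* Each of the [n] terms is bounded below by the power of the largest index [n + n]. *)
have -> : (2 `^ kappa)^-1 * (n%:R `^ (kappa - 1))^-1 =
    \sum_(n.+1 <= j < (n + n).+1) ((n + n)%:R `^ kappa)^-1 :> R.
  rewrite sumr_const_nat subSS addnK -[RHS]mulr_natr addnn -mul2n natrM powRM ?ler0n//.
  rewrite -(mulr_powRB1 (ltW n0R) kappa_gt0).
  by field; rewrite !gt_eqF ?powR_gt0.
apply: ler_sum_nat => j /andP[nj jn].
rewrite lef_pV2 ?posrE ?powR_gt0 ?ltr0n ?addn_gt0 ?n0//; last exact: leq_ltn_trans nj.
by rewrite ge0_ler_powR ?nnegrE ?ler0n ?ler_nat// ltW// (lt_trans ltr01).
Qed.

End zeta_tails.

(** * The coding map and the geometry of its cylinders *)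

Section coding_map.
Context {R : realType} (kappa : R).
Hypothesis kappa_gt1 : 1 < kappa.

Local Notation width := (width kappa).
Local Notation f := (f kappa).
Local Notation P := (P kappa).
Local Notation a := (a kappa).

Definition inverse_branch (k : nat) (y : R) : R := a k + width k * y.

Lemma PS_E k x : P k.+1 x = (a k <= x < a k.+1) :> Prop.
Proof. by rewrite /Defs.P /= in_itv. Qed.

Lemma branchE k x : P k.+1 x -> branch kappa x = k.+1.
Proof.
move=> Pk; have [] : [set n | (0 < n)%N /\ P n x] (branch kappa x).
  by apply: getPex; exists k.+1.
case: (branch kappa x) => // n _.
move: Pk; rewrite !PS_E => /andP[ak ka] /andP[an na].
congr _.+1; apply/eqP; rewrite eqn_leq; apply/andP; split; rewrite leqNgt; apply/negP.
  by move=> /(a_homo_le _ kappa_gt1) /(lt_le_trans ka); rewrite ltNge an.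
by move=> /(a_homo_le _ kappa_gt1) /(lt_le_trans na); rewrite ltNge ak.
Qed.

Lemma f_branch k x : P k.+1 x -> f x = (width k)^-1 * (x - a k).
Proof. by move=> Pk; rewrite /Defs.f (branchE _ _ Pk) /width invrK. Qed.

Lemma fK k x : P k.+1 x -> inverse_branch k (f x) = x.
Proof.
move=> Pk; rewrite /inverse_branch (f_branch _ _ Pk) mulVKf ?subrKC//.
by rewrite gt_eqF// width_gt0.
Qed.

Lemma P_inverse_branch k y : 0 <= y < 1 -> P k.+1 (inverse_branch k y).
Proof.
move=> /andP[y0 y1]; have w0 := width_gt0 _ kappa_gt1 k.
by rewrite PS_E /inverse_branch lerDl mulr_ge0 ?(ltW w0)//= aS ltrD2l gtr_pMr.
Qed.

Lemma inverse_branchK k y : 0 <= y < 1 -> f (inverse_branch k y) = y.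
Proof.
move=> y01; rewrite (f_branch _ _ (P_inverse_branch k _ y01)) /inverse_branch.
by rewrite addrC addKr mulKf// gt_eqF// width_gt0.
Qed.

Definition shift (i : nat -> nat) : nat -> nat := fun j => i j.+1.

(** Image of 0 under the first [n] inverse branches: the left end of the interval coded by the first
    [n] letters of [i]. *)
Fixpoint left_end (n : nat) (i : nat -> nat) : R :=
  if n is m.+1 then inverse_branch (i 0%N) (left_end m (shift i)) else 0.

Definition point (i : nat -> nat) : R := limn (left_end ^~ i).

Lemma left_end_itv n i : 0 <= left_end n i < 1.
Proof.
elim: n i => [|n IHn] i /=; first by rewrite lexx ltr01.
have := P_inverse_branch (i 0%N) _ (IHn (shift i)); rewrite PS_E => /andP[h1 h2].
by rewrite (le_trans (a_ge0 _ kappa_gt1 _) h1) (lt_trans h2 (a_lt1 _ kappa_gt1 _)).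
Qed.

Lemma left_end_nondecreasing i : nondecreasing_seq (left_end ^~ i).
Proof.
apply/nondecreasing_seqP => n; elim: n i => [|n IHn] i.
  by have /andP[] := left_end_itv 1 i.
by rewrite [leLHS]/= [leRHS]/= lerD2l ler_pM2l ?IHn ?width_gt0.
Qed.

Lemma left_end_cvg i : cvgn (left_end ^~ i).
Proof.
apply: nondecreasing_is_cvgn; first exact: left_end_nondecreasing.
by exists 1 => _ [n _ <-]; have /andP[_ /ltW] := left_end_itv n i.
Qed.

(** Inverse branches are affine, hence continuous, so the recursion of [left_end] passes to the
    limit. *)
Lemma pointE i : point i = inverse_branch (i 0%N) (point (shift i)).
Proof.
apply/cvg_lim => //; rewrite -cvg_shiftS /=.
apply: cvgD; first exact: cvg_cst.
by apply: cvgMr; exact: left_end_cvg.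
Qed.

(* The bound < 1, which makes the half-open intervals work, comes from
   point i <= a (i 0).+1. *)
Lemma point_itv i : 0 <= point i < 1.
Proof.
have ge0 j : 0 <= point j.
  apply: limr_ge; first exact: left_end_cvg.
  by apply: nearW => n; have /andP[] := left_end_itv n j.
rewrite ge0/= pointE; apply: le_lt_trans (a_lt1 _ kappa_gt1 (i 0%N).+1).
rewrite aS lerD2l ger_pMr ?width_gt0//.
apply: limr_le; first exact: left_end_cvg.
by apply: nearW => n; have /andP[_ /ltW] := left_end_itv n (shift i).
Qed.

(** As [coding] is chosen by [get], a witness is needed: [point i], on which [f] acts as the shift
    on [i]. *)
Lemma coding_spec (i : shift_space) j : P (i j).+1 (iter j f (coding kappa i)).
Proof.
move: j; apply: (@getPex _ [set x | forall j, P (i j).+1 (iter j f x)]).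
exists (point i) => j; elim: j i => [|j IHj] i.
  by rewrite /= pointE; exact: P_inverse_branch (point_itv _).
by rewrite iterSr pointE inverse_branchK ?point_itv//; exact: IHj.
Qed.

Lemma iter_f_coding_itv (i : shift_space) n :
  a (i n) <= iter n f (coding kappa i) < 1.
Proof.
have := coding_spec i n; rewrite PS_E => /andP[-> /lt_trans]/=.
by apply; exact: a_lt1.
Qed.

Definition cylinder_length (s : seq nat) : R := \prod_(k <- s) width k.

Lemma cylinder_length_gt0 s : 0 < cylinder_length s.
Proof. by apply: prodr_gt0 => k _; exact: width_gt0. Qed.

Lemma width_le k : width k <= (zeta_kappa kappa)^-1.
Proof.
have c1 := zeta_kappa_gt1 _ kappa_gt1.
have c0 : 0 < zeta_kappa kappa by exact: lt_trans c1.
rewrite lef_pV2 ?posrE ?mulr_gt0 ?powR_gt0//.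
rewrite ler_peMr ?(ltW c0)//.
have k1 : 1 <= k.+1%:R :> R by rewrite ler1n.
exact: le_trans k1 (le1r_powR k1 (ltW kappa_gt1)).
Qed.

Lemma cylinder_length_le s : cylinder_length s <= (zeta_kappa kappa)^-1 ^+ size s.
Proof.
rewrite /cylinder_length; elim: s => [|k s IHs]; first by rewrite big_nil expr0.
rewrite big_cons /= exprS ler_pM ?width_le ?(ltW (width_gt0 _ kappa_gt1 _))//.
exact: ltW (cylinder_length_gt0 s).
Qed.

(** Along the common itinerary [s], each step of both orbits is undone by the same affine inverse
    branch, of slope [width k]. *)
Lemma affine_on_cylinder s x y :
  (forall j, (j < size s)%N -> P (nth 0%N s j).+1 (iter j f x)) ->
  (forall j, (j < size s)%N -> P (nth 0%N s j).+1 (iter j f y)) ->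
  x - y = cylinder_length s * (iter (size s) f x - iter (size s) f y).
Proof.
rewrite /cylinder_length; elim: s x y => [|k s IHs] x y px py.
  by rewrite big_nil mul1r.
rewrite big_cons -mulrA [size _]/= !iterSr -IHs; last 2 first.
- by move=> j js; rewrite -iterSr; exact: (px j.+1).
- by move=> j js; rewrite -iterSr; exact: (py j.+1).
rewrite -{1}(fK k x (px 0%N isT)) -{1}(fK k y (py 0%N isT)).
by rewrite /inverse_branch; ring.
Qed.

(** After [size s] steps both points lie in [[a N, 1[], and [affine_on_cylinder] scales their
    distance back. The case [N = 0] bounds the diameter of a cylinder; large [N] concerns the part
    near its right end. *)
Lemma coding_dist_lt s N (i j : shift_space) :
  cylinder s i -> cylinder s j ->
  (N <= i (size s))%N -> (N <= j (size s))%N ->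
  `|coding kappa i - coding kappa j| < cylinder_length s * (1 - a N).
Proof.
move=> si sj Ni Nj; rewrite (affine_on_cylinder s); last 2 first.
- by move=> l ls; rewrite -si//; exact: coding_spec.
- by move=> l ls; rewrite -sj//; exact: coding_spec.
have := cylinder_length_gt0 s => l0.
rewrite normrM gtr0_norm// ltr_pM2l//.
have /andP[i0 i1] := iter_f_coding_itv i (size s).
have /andP[j0 j1] := iter_f_coding_itv j (size s).
have := a_homo_le _ kappa_gt1 _ _ Ni; have := a_homo_le _ kappa_gt1 _ _ Nj.
by rewrite ltr_norml => ? ?; apply/andP; split; lra.
Qed.

End coding_map.

(** * Bounds on upper and lower limits along a filter *)

Section limits_superior.
Context {T : choiceType} {X : filteredType T} {R : realType}.
Variables (g : X -> \bar R) (F : set_system X).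
Local Open Scope ereal_scope.

Lemma limf_esup_ge_near (b : \bar R) : ProperFilter F ->
  (\forall x \near F, b <= g x) -> b <= limf_esup g F.
Proof.
move=> FF gb; rewrite limf_esupE; apply: le_ereal_inf_tmp => _ [V FV <-].
have [x [Vx bx]] := filter_ex (filterI FV gb).
by apply: le_trans bx _; apply: ereal_sup_ubound; exists x.
Qed.

Lemma limf_esup_le_near (b : \bar R) :
  (\forall x \near F, g x <= b) -> limf_esup g F <= b.
Proof.
move=> gb; rewrite limf_esupE.
apply: le_trans (_ : ereal_sup (g @` [set x | g x <= b]) <= b).
  by apply: ereal_inf_lbound; exists [set x | g x <= b].
by apply: ge_ereal_sup => _ [x + <-].
Qed.

End limits_superior.

Lemma limf_einf_le_near {T : choiceType} {X : filteredType T} {R : realType}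
    (g : X -> \bar R) (F : set_system X) (b : \bar R) : ProperFilter F ->
  (\forall x \near F, g x <= b)%E -> (limf_einf g F <= b)%E.
Proof.
move=> FF gb; rewrite /limf_einf leeNl; apply: limf_esup_ge_near.
by apply: filterS gb => x; rewrite leeN2.
Qed.

Lemma limf_einf_ge_near {T : choiceType} {X : filteredType T} {R : realType}
    (g : X -> \bar R) (F : set_system X) (b : \bar R) : Filter F ->
  (\forall x \near F, b <= g x)%E -> (b <= limf_einf g F)%E.
Proof.
move=> FF gb; rewrite /limf_einf leeNr; apply: limf_esup_le_near.
by apply: filterS gb => x; rewrite leeN2.
Qed.

(** * Logarithmic rates of a function with stretched exponential decay *)

Section ln_expR.
Context {R : realType}.
Implicit Types x y : R.

Lemma ln_le_expR x y : 0 < x -> (ln x <= y) = (x <= expR y).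
Proof. by move=> x0; rewrite -ler_expR lnK. Qed.

Lemma expR_le_ln x y : 0 < x -> (y <= ln x) = (expR y <= x).
Proof. by move=> x0; rewrite -ler_expR lnK. Qed.

End ln_expR.

Section stretched_exponential_decay.
Context {R : realType}.
Variables (m : R -> R) (s d D : R).
Hypotheses (s0 : 0 < s) (d0 : 0 < d) (D0 : 0 < D).
Hypothesis m_bounds : \forall r \near (0 : R)^'+,
  expR (- (D * (r `^ s)^-1)) <= m r <= expR (- (d * (r `^ s)^-1)).

Let near_ln (A : R) : \forall r \near (0 : R)^'+, A <= - ln r.
Proof.
near=> r; have r0 : 0 < r by [].
rewrite lerNr ln_le_expR//.
by near: r; apply: nbhs_right_le; exact: expR_gt0.
Unshelve. all: by end_near. Qed.

Let near_lnm : \forall r \near (0 : R)^'+,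
  d * expR (s * - ln r) <= - ln (m r) <= D * expR (s * - ln r).
Proof.
apply: filterS2 m_bounds (nbhs_right_gt 0) => r /andP[m1 m2] r0.
have -> : expR (s * - ln r) = (r `^ s)^-1.
  by rewrite /powR gt_eqF// mulrN expRN.
have m0 : 0 < m r by apply: lt_le_trans m1; exact: expR_gt0.
by rewrite lerNr ln_le_expR// m2/= lerNl expR_le_ln.
Qed.

(** A second logarithm turns the constants [d] and [D] into additive errors [ln d] and [ln D], which
    vanish after division by [- ln r]. *)
Let near_stretched (e : R) : 0 < e -> \forall r \near (0 : R)^'+,
  `|ln `|ln (m r)| / - ln r - s| <= e.
Proof.
move=> e0; near=> r.
have [r1 r2] : 1 <= - ln r /\ (`|ln d| + `|ln D|) / e <= - ln r.
  by split; near: r; exact: near_ln.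
have /andP[m1 m2] : d * expR (s * - ln r) <= - ln (m r) <= D * expR (s * - ln r).
  by near: r; exact: near_lnm.
have L0 : 0 < - ln r by apply: lt_le_trans r1.
have m0 : 0 < - ln (m r) by apply: lt_le_trans m1; rewrite mulr_gt0 ?expR_gt0.
have -> : `|ln (m r)| = - ln (m r) by rewrite ltr0_norm// -oppr_gt0.
have -> : ln (- ln (m r)) / - ln r - s = (ln (- ln (m r)) - s * - ln r) / - ln r.
  by field; rewrite -oppr_eq0 gt_eqF.
rewrite normrM [X in _ * X]ger0_norm ?invr_ge0 ?(ltW L0)// ler_pdivrMr//.
move: r2; rewrite ler_pdivrMr// [- ln r * e]mulrC; apply: le_trans.
have {}m1 : ln d + s * - ln r <= ln (- ln (m r)).
  by rewrite expR_le_ln// expRD lnK.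
have {}m2 : ln (- ln (m r)) <= ln D + s * - ln r.
  by rewrite ln_le_expR// expRD lnK.
have := ler_norm (ln D); have := ler_norm (- ln d); rewrite normrN.
have := normr_ge0 (ln d); have := normr_ge0 (ln D).
by rewrite ler_norml => ? ? ? ?; apply/andP; split; lra.
Unshelve. all: by end_near. Qed.

Let near_ratio (A : R) : \forall r \near (0 : R)^'+, A <= ln (m r) / ln r.
Proof.
near=> r.
(* Put [L = - ln r]. The ratio is at least [d * expR (s * L) / L], hence at least
   [d * (s / 2) ^+ 2 * L], which the second threshold raises above [A]. *)
have [r1 r2] : 1 <= - ln r /\ A / (d * (s / 2) ^+ 2) <= - ln r.
  by split; near: r; exact: near_ln.
have /andP[m1 _] : d * expR (s * - ln r) <= - ln (m r) <= D * expR (s * - ln r).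
  by near: r; exact: near_lnm.
have L0 : 0 < - ln r by apply: lt_le_trans r1.
rewrite -[_ / _]mulrNN -invrN ler_pdivlMr//; apply: le_trans m1.
(* [expR x >= (x / 2) ^+ 2] *)
have -> : s * - ln r = s / 2 * - ln r + s / 2 * - ln r by field.
rewrite expRD; move: r2; rewrite ler_pdivrMr; last first.
  by rewrite mulr_gt0// exprn_gt0// divr_gt0.
move=> r2; have {}r2 : A * - ln r <= - ln r * (d * (s / 2) ^+ 2) * - ln r.
  by rewrite ler_pM2r.
apply: le_trans r2 _.
have -> : - ln r * (d * (s / 2) ^+ 2) * - ln r =
  d * ((s / 2 * - ln r) * (s / 2 * - ln r)) by ring.
have x0 : 0 <= s / 2 * - ln r by rewrite mulr_ge0 ?divr_ge0 ?ltW.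
have x1 : s / 2 * - ln r <= expR (s / 2 * - ln r).
  by apply: le_trans (expR_ge1Dx _); rewrite lerDr.
by rewrite ler_pM2l// ler_pM.
Unshelve. all: by end_near. Qed.

Lemma limf_esup_ln_ratio :
  limf_esup (fun r => (ln (m r) / ln r)%:E) (0 : R)^'+ = +oo%E.
Proof.
apply/eqyP => A A0; apply: limf_esup_ge_near.
by apply: filterS (near_ratio A) => r; rewrite lee_fin.
Qed.

Lemma limf_stretched_ratio :
  limf_esup (fun r => (ln `|ln (m r)| / - ln r)%:E) (0 : R)^'+ = s%:E /\
  limf_einf (fun r => (ln `|ln (m r)| / - ln r)%:E) (0 : R)^'+ = s%:E.
Proof.
split; apply/eqP; rewrite eq_le; apply/andP; split.
- apply/lee_addgt0Pr => e e0; apply: limf_esup_le_near.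
  apply: filterS (near_stretched e e0) => r; rewrite ler_norml => /andP[_].
  by rewrite lerBlDl -EFinD lee_fin addrC.
- apply/lee_subgt0Pr => e e0; apply: limf_esup_ge_near.
  apply: filterS (near_stretched e e0) => r; rewrite ler_norml => /andP[+ _].
  by rewrite lerBrDl -EFinB lee_fin.
- apply/lee_addgt0Pr => e e0; apply: limf_einf_le_near.
  apply: filterS (near_stretched e e0) => r; rewrite ler_norml => /andP[_].
  by rewrite lerBlDl -EFinD lee_fin addrC.
- apply/lee_subgt0Pr => e e0; apply: limf_einf_ge_near.
  apply: filterS (near_stretched e e0) => r; rewrite ler_norml => /andP[+ _].
  by rewrite lerBrDl -EFinB lee_fin.
Qed.

End stretched_exponential_decay.

(** * Cylinder sets and measurability of the coding map *)

Lemma measurable_cylinder (s : seq nat) :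
  measurable (cylinder s : set shift_space).
Proof. by apply: sub_gen_smallest; exists s. Qed.

Lemma cylinder_mkseq (i : nat -> nat) n : cylinder (mkseq i n) i.
Proof. by move=> j; rewrite size_mkseq => jn; rewrite nth_mkseq. Qed.

Lemma cylinder_rcons (s : seq nat) k (i : nat -> nat) :
  cylinder (rcons s k) i <-> cylinder s i /\ i (size s) = k.
Proof.
split=> [si|[si ik] j].
  split=> [j js|]; last by rewrite si ?size_rcons// nth_rcons ltnn eqxx.
  by rewrite si ?size_rcons 1?ltnW// nth_rcons js.
rewrite size_rcons ltnS leq_eqVlt nth_rcons => /predU1P[->|js].
  by rewrite ltnn eqxx.
by rewrite js si.
Qed.

Section measurability.
Context {R : realType} (kappa : R).
Hypothesis kappa_gt1 : 1 < kappa.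

Local Notation len := (cylinder_length kappa).
Local Notation coding := (coding kappa).

Lemma cylinder_length_small (i : nat -> nat) (r : R) : 0 < r ->
  exists n, len (mkseq i n) <= r.
Proof.
move=> r0; have c1 := zeta_kappa_gt1 _ kappa_gt1.
have c0 : 0 < zeta_kappa kappa by exact: lt_trans c1.
have : `|(zeta_kappa kappa)^-1| < 1 by rewrite gtr0_norm ?invr_gt0// invf_lt1.
move=> /cvg_expr /cvgr0Pnorm_le /(_ _ r0) [n _ /(_ n (leqnn n))] /=.
rewrite ger0_norm ?exprn_ge0 ?invr_ge0 ?(ltW c0)// => nr.
exists n; apply: le_trans nr; rewrite -[X in _ ^+ X](size_mkseq i n).
exact: cylinder_length_le.
Qed.

Lemma coding_dist_cylinder s (i j : shift_space) :
  cylinder s i -> cylinder s j -> `|coding i - coding j| < len s.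
Proof.
move=> si sj; have := coding_dist_lt _ kappa_gt1 s 0 _ _ si sj isT isT.
by rewrite a0 subr0 mulr1.
Qed.

(** Since cylinder intervals shrink to points, the preimage is the union of the cylinders it
    contains, and there are only countably many finite words. *)
Lemma measurable_coding_open (U : set R) : open U ->
  measurable (coding @^-1` U : set shift_space).
Proof.
move=> oU.
have -> : coding @^-1` U = \bigcup_(s in [set s | cylinder s `<=` coding @^-1` U])
    (cylinder s : set shift_space).
  apply/seteqP; split=> [i Ui|i [s]]; last exact.
  have /open_nbhs_nbhs/nbhs_ballP[e /= e0 eU] : open_nbhs (coding i) U by [].
  have [n ne] := cylinder_length_small i _ e0.
  exists (mkseq i n); last exact: cylinder_mkseq.
  move=> j sj; apply: eU => /=; rewrite -ball_normE /=.
  by apply: lt_le_trans ne; apply: coding_dist_cylinder => //; exact: cylinder_mkseq.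
rewrite bigcup_mkcond; apply: countable_bigcupT_measurable.
  exact: countableP.
by move=> s; case: ifPn => // _; exact: measurable_cylinder.
Qed.

End measurability.

(** * Letters compared with powers of the radius *)

Section letter_powers.
Context {R : realType} (kappa : R).
Hypothesis kappa_gt1 : 1 < kappa.
Local Notation sigma := ((kappa - 1)^-1).
Local Notation a := (a kappa).

Let sigma_gt0 : 0 < sigma. Proof. by rewrite invr_gt0 subr_gt0. Qed.

(** Converts the two bounds on [1 - a n] into thresholds for [n] of order [r ^ - sigma]. *)
Lemma le_powR_sigma (x y : R) : 0 <= x -> 0 <= y ->
  (x <= y `^ sigma) = (x `^ (kappa - 1) <= y).
Proof.
move=> x0 y0; have b0 : 0 < kappa - 1 by rewrite subr_gt0.
have yE : (y `^ sigma) `^ (kappa - 1) = y.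
  by rewrite -powRrM mulVf ?gt_eqF// powRr1.
have xE : (x `^ (kappa - 1)) `^ sigma = x.
  by rewrite -powRrM divff ?gt_eqF// powRr1.
apply/idP/idP => h.
- by rewrite -yE ge0_ler_powR ?nnegrE ?powR_ge0// ltW.
- by rewrite -[leLHS]xE ge0_ler_powR ?nnegrE ?powR_ge0// ltW.
Qed.

Lemma a_tail_lt_radius (n : nat) (r : R) : 0 < r ->
  ((zeta_kappa kappa * (kappa - 1))^-1 / r) `^ sigma < n%:R -> 1 - a n < r.
Proof.
move=> r0 rn; have b0 : 0 < kappa - 1 by rewrite subr_gt0.
have c0 : 0 < zeta_kappa kappa by exact: lt_trans (zeta_kappa_gt1 _ kappa_gt1).
have n0 : (0 < n)%N by rewrite -(ltr0n R); apply: le_lt_trans rn; exact: powR_ge0.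
apply: le_lt_trans (a_tail_le _ kappa_gt1 _ n0) _.
have K0 : 0 <= (zeta_kappa kappa * (kappa - 1))^-1 / r.
  by apply: divr_ge0; rewrite ?invr_ge0 ?mulr_ge0// ltW.
move: rn; rewrite ltNge le_powR_sigma ?ler0n// -ltNge ltr_pdivrMr// => rn.
by rewrite ltr_pdivrMr ?powR_gt0 ?ltr0n// [r * _]mulrC.
Qed.

Lemma radius_le_a_tail (n : nat) (r : R) : (0 < n)%N -> 0 < r ->
  n%:R <= ((zeta_kappa kappa * 2 `^ kappa)^-1 / r) `^ sigma -> r <= 1 - a n.
Proof.
move=> n0 r0 nr.
have c0 : 0 < zeta_kappa kappa by exact: lt_trans (zeta_kappa_gt1 _ kappa_gt1).
apply: le_trans (a_tail_ge _ kappa_gt1 _ n0).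
have K0 : 0 <= (zeta_kappa kappa * 2 `^ kappa)^-1 / r.
  by apply: divr_ge0; rewrite ?invr_ge0 ?mulr_ge0 ?powR_ge0// ltW.
move: nr; rewrite le_powR_sigma ?ler0n// ler_pdivlMr// => nr.
by rewrite ler_pdivlMr ?powR_gt0 ?ltr0n// [r * _]mulrC.
Qed.

(* Induction on the word: for [X = width k ^ - sigma >= zeta_kappa ^ sigma * k.+1]
   and [Y >= 1] one has [W * k.+1 + B * Y <= B * X * Y] as soon as
   [B * (zeta_kappa ^ sigma - 1) = W]; here [kappa * sigma > 1] is used. *)
Lemma expR_le_prod_letters (q : nat -> R) (W : R) : 0 < W ->
  (forall k, expR (- (W * k.+1%:R)) <= q k) ->
  exists2 B, 0 < B & forall s,
    expR (- (B * (cylinder_length kappa s `^ sigma)^-1)) <= \prod_(k <- s) q k.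
Proof.
move=> W0 qW; have c1 := zeta_kappa_gt1 _ kappa_gt1.
set C := zeta_kappa kappa `^ sigma.
have c0 : 0 < zeta_kappa kappa by exact: lt_trans c1.
have C1 : 1 < C.
  by rewrite -(powRr0 (zeta_kappa kappa)) /C /powR gt_eqF// mul0r ltr_expR mulr_gt0// ln_gt0.
have B0 : 0 < W / (C - 1) by rewrite divr_gt0 ?subr_gt0.
exists (W / (C - 1)) => //; set B := W / (C - 1) in B0 *.
elim=> [|k s IHs].
  rewrite big_nil -[leRHS]expR0 ler_expR oppr_le0 mulr_ge0 ?(ltW B0)//.
  by rewrite invr_ge0 powR_ge0.
rewrite big_cons; apply: le_trans (ler_pM _ _ (qW k) IHs); rewrite ?expR_ge0//.
have w0 := width_gt0 _ kappa_gt1 k.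
have l0 := cylinder_length_gt0 _ kappa_gt1 s.
rewrite -expRD ler_expR -opprD lerN2 [cylinder_length _ (_ :: _)]big_cons.
rewrite -/(cylinder_length kappa s) powRM ?(ltW w0) ?(ltW l0)// invfM.
set Y := (cylinder_length kappa s `^ sigma)^-1.
have Y1 : 1 <= Y.
  have e1 : 1 `^ sigma = 1 :> R by rewrite powR1.
  rewrite invf_ge1 ?powR_gt0// -[leRHS]e1.
  rewrite ge0_ler_powR ?nnegrE ?(ltW l0) ?(ltW sigma_gt0)//.
  apply: le_trans (cylinder_length_le _ kappa_gt1 s) _.
  by rewrite exprn_ile1 ?invr_ge0 ?(ltW c0)// invf_le1// ltW.
have X1 : C * k.+1%:R <= (width kappa k `^ sigma)^-1.
  have m0 : 0 < k.+1%:R :> R by rewrite ltr0n.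
  have cm0 : 0 < zeta_kappa kappa * k.+1%:R `^ kappa by rewrite mulr_gt0// powR_gt0.
  rewrite /width -[(zeta_kappa kappa * _)^-1](powR_inv1 (ltW cm0)) -powRrM mulN1r powRN invrK.
  rewrite powRM ?powR_ge0 ?(ltW c0)// ler_pM2l ?powR_gt0// -powRrM.
  apply: le1r_powR; first by rewrite ler1n.
  by rewrite ler_pdivlMr ?subr_gt0// mul1r gerBl.
set X := (width kappa k `^ sigma)^-1 in X1 *.
have WB : W = B * (C - 1) by rewrite /B divfK// subr_eq0 gt_eqF.
have k1 : 1 <= k.+1%:R :> R by rewrite ler1n.
have C10 : 0 < C - 1 by rewrite subr_gt0.
(* Subtract [k.+1 >= 1] from [C * k.+1 <= X]. *)
have Xk : (C - 1) * k.+1%:R <= X - 1 by nra.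
have X10 : 0 <= X - 1 by apply: le_trans Xk; rewrite mulr_ge0// ltW.
have XY : X - 1 <= (X - 1) * Y by rewrite ler_peMr.
have : B * ((C - 1) * k.+1%:R) <= B * ((X - 1) * Y).
  by rewrite ler_pM2l//; apply: le_trans Xk XY.
by rewrite WB; lra.
Qed.
End letter_powers.

(** * Measures of balls under the image of the Bernoulli measure *)

Section bernoulli_image.
Context {R : realType} (kappa omega C Z : R).
Variable nu : {finite_measure set shift_space -> \bar R}.
Hypotheses (kappa_gt1 : 1 < kappa) (omega_gt1 : 1 < omega).
Hypotheses (C0 : 0 < C) (Z0 : 0 < Z).
Hypothesis nu_cylinder : forall s : seq nat,
  nu (cylinder s) = (C * \prod_(k <- s) (omega ^- k.+1 / Z))%:E.

Local Notation sigma := ((kappa - 1)^-1).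
Local Notation coding := (coding kappa).
Local Notation mu := (pushforward nu coding).
Local Notation len := (cylinder_length kappa).
Local Notation a := (a kappa).

Let omega0 : 0 < omega. Proof. exact: lt_trans omega_gt1. Qed.
Let sigma0 : 0 < sigma. Proof. by rewrite invr_gt0 subr_gt0. Qed.
Let lnomega0 : 0 < ln omega. Proof. exact: ln_gt0. Qed.

Let exp_omega n : omega ^- n = expR (- (ln omega * n%:R)).
Proof. by rewrite expRN mulrC expRM_natl lnK. Qed.

(** The normalisation adds [ln Z] to the cost of every letter; as [k.+1 >= 1], it is absorbed into a
    cost linear in [k.+1]. *)
Let W := ln omega + `|ln Z|.

Let W0 : 0 < W. Proof. by rewrite ltr_pwDl. Qed.

Let letter_ge k : expR (- (W * k.+1%:R)) <= omega ^- k.+1 / Z.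
Proof.
rewrite exp_omega -(lnK Z0) -expRN -expRD ler_expR -opprD lerN2 mulrDl lerD2l.
apply: le_trans (ler_norm _) _; by rewrite ler_peMr// ler1n.
Qed.

Lemma le_measure_cylinder (s : seq nat) (U : set R) : open U ->
  cylinder s `<=` coding @^-1` U ->
  ((C * \prod_(k <- s) (omega ^- k.+1 / Z))%:E <= mu U)%E.
Proof.
move=> oU sU; rewrite -nu_cylinder; apply: le_measure => //; rewrite inE.
- exact: measurable_cylinder.
- exact: measurable_coding_open.
Qed.

(* [s] is the longest prefix of [i] whose cylinder has length above [r]; if the
   next letter exceeds [N], replacing it by [N] stays in the part of the cylinder
   near its right end, which is shorter than [r]. *)
Lemma cylinder_in_ball (i : shift_space) (r : R) (N : nat) :
  0 < r -> r < 1 -> 1 - a N < r ->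
  exists s k, [/\ r <= len s, (k <= N)%N &
    cylinder (rcons s k) `<=` coding @^-1` (ball (coding i) r)].
Proof.
move=> r0 r1 Nr.
(* The least prefix size with length at most [r] is not 0, the empty word having length 1; its
   predecessor [n] gives [s]. *)
case: (ex_minnP (cylinder_length_small _ kappa_gt1 i r r0)) => -[|n].
  by rewrite /cylinder_length big_nil leNgt r1.
move=> nr nmin; have rn : r < len (mkseq i n).
  by rewrite ltNge; apply/negP => /nmin; rewrite ltnn.
have mkseqS : mkseq i n.+1 = rcons (mkseq i n) (i n).
  by rewrite /mkseq -addn1 iotaD map_cat /= add0n cats1.
exists (mkseq i n), (minn (i n) N); split; [exact: ltW|exact: geq_minr|].
move=> j /= sj; rewrite -ball_normE /=.
case: (leqP (i n) N) sj => [iN|Ni] sj.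
  apply: lt_le_trans nr; apply: coding_dist_cylinder => //.
    exact: cylinder_mkseq.
  by rewrite mkseqS.
move/cylinder_rcons : sj => []; rewrite size_mkseq => sj jN.
have := coding_dist_lt _ kappa_gt1 (mkseq i n) N i j (cylinder_mkseq i n) sj.
rewrite size_mkseq jN => /(_ (ltnW Ni) (leqnn N)) /lt_trans; apply.
apply: le_lt_trans Nr; rewrite ler_piMl ?subr_ge0 ?(ltW (a_lt1 _ kappa_gt1 _))//.
apply: le_trans (cylinder_length_le _ kappa_gt1 _) _.
have c1 := zeta_kappa_gt1 _ kappa_gt1.
rewrite exprn_ile1 ?invr_ge0 ?(ltW (lt_trans ltr01 c1))//.
by rewrite invf_le1 ?(ltW c1)// (lt_trans ltr01).
Qed.

Lemma ball_measure_ge : exists2 D, 0 < D & forall x r, 0 < r -> r <= 1 ->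
  msupp mu x -> ((expR (- (D * (r `^ sigma)^-1)))%:E <= mu (ball x r))%E.
Proof.
have [B B0 Bq] := expR_le_prod_letters _ kappa_gt1 _ _ W0 letter_ge.
set K := (zeta_kappa kappa * (kappa - 1))^-1.
have c0 : 0 < zeta_kappa kappa by exact: lt_trans (zeta_kappa_gt1 _ kappa_gt1).
have K0 : 0 < K by rewrite invr_gt0 mulr_gt0// subr_gt0.
(* The summands pay for the factor [C], for the prefix, whose length is at least [r / 2], and for
   the last letter; the final [2] comes from rounding in [N] and from [k.+1]. Terms without [r] are
   absorbed because [r <= 1]. *)
exists (`|ln C| + B * 2 `^ sigma + W * ((2 * K) `^ sigma + 2)).
  rewrite ltr_pwDl//; first by rewrite ltr_wpDl// mulr_gt0// powR_gt0.
  by rewrite mulr_ge0 ?addr_ge0 ?powR_ge0// ltW.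
move=> x r r0 r1 suppx.
have r20 : 0 < r / 2 by rewrite divr_gt0.
(* A point of the support, such as 1, need not be coded. Half of the radius is spent on reaching a
   coded point, which exists because the smaller ball has positive measure. *)
have [i ixr] : exists i, ball x (r / 2) (coding i).
  have : (0 < mu (ball x (r / 2)))%E.
    by apply: suppx; split; [exact: ball_open|exact: ballxx].
  apply: contraPP => /forallNP noi.
  rewrite /pushforward (_ : _ @^-1` _ = set0) ?measure0 ?ltxx//.
  by apply/seteqP; split => // i /noi.
set N := (Num.truncn ((K / (r / 2)) `^ sigma)).+1.
have Nr : 1 - a N < r / 2.
  by apply: a_tail_lt_radius => //; exact: truncnS_gt.
have r21 : r / 2 < 1 by lra.
have [s [k [rs kN sub]]] := cylinder_in_ball i _ _ r20 r21 Nr.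
apply: le_trans (le_measure_cylinder (rcons s k) _ (ball_open x r) _); last first.
  by move=> j /sub /= ij; rewrite (splitr r); apply: ball_triangle ixr ij.
rewrite lee_fin -cats1 big_cat big_seq1.
have := ler_pM (expR_ge0 _) (expR_ge0 _) (Bq s) (letter_ge k).
rewrite -(ler_pM2l C0); apply: le_trans.
rewrite -[X in _ <= X * _](lnK C0) -!expRD ler_expR.
set Y := (r `^ sigma)^-1.
have Y1 : 1 <= Y.
  have e1 : 1 `^ sigma = 1 :> R by rewrite powR1.
  rewrite invf_ge1 ?powR_gt0// -[leRHS]e1.
  by rewrite ge0_ler_powR ?nnegrE ?(ltW r0) ?(ltW sigma0).
have h1 : (len s `^ sigma)^-1 <= 2 `^ sigma * Y.
  have l0 := cylinder_length_gt0 _ kappa_gt1 s.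
  rewrite ler_pdivlMr ?powR_gt0// ler_pdivrMl ?powR_gt0// mulrC.
  rewrite -powRM ?(ltW l0)// ge0_ler_powR ?nnegrE ?mulr_ge0 ?(ltW r0) ?(ltW l0) ?(ltW sigma0)//.
  by move: rs; rewrite ler_pdivrMr// mulrC.
have h2 : k.+1%:R <= (2 * K) `^ sigma * Y + 2.
  apply: (@le_trans _ _ N.+1%:R); first by rewrite ler_nat ltnS.
  rewrite /N -addn2 natrD lerD2r.
  have -> : (2 * K) `^ sigma * Y = (K / (r / 2)) `^ sigma.
    have -> : 2 * K = K / (r / 2) * r by field; rewrite gt_eqF.
    by rewrite powRM ?divr_ge0 ?ltW// mulfK// gt_eqF// powR_gt0.
  by rewrite truncn_le powR_ge0.
have h3 : B * (len s `^ sigma)^-1 <= B * (2 `^ sigma * Y) by rewrite ler_pM2l.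
have h4 : W * k.+1%:R <= W * ((2 * K) `^ sigma * Y + 2) by rewrite ler_pM2l.
have h5 : `|ln C| <= `|ln C| * Y by rewrite ler_peMr.
have h6 : W * 2 <= W * 2 * Y by rewrite ler_peMr// mulr_ge0// ltW.
have h7 := ler_norm (- ln C); rewrite normrN in h7.
by lra.
Qed.

(** The point 1 is not coded, but every neighbourhood of it contains all points with first letter
    [N], for [N] large. *)
Lemma one_in_msupp : msupp mu 1.
Proof.
move=> U /[dup] -[oU _] /open_nbhs_nbhs/nbhs_ballP[e /= e0 eU].
set K := (zeta_kappa kappa * (kappa - 1))^-1.
set N := (Num.truncn ((K / e) `^ sigma)).+1.
have Ne : 1 - a N < e by apply: a_tail_lt_radius => //; exact: truncnS_gt.
have := le_measure_cylinder [:: N] _ oU; rewrite big_seq1 => h.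
apply: lt_le_trans (h _); first by rewrite lte_fin mulr_gt0 ?divr_gt0 ?invr_gt0 ?exprn_gt0.
move=> i /(_ 0%N isT) /= iN; apply: eU; rewrite -ball_normE /=.
have := iter_f_coding_itv _ kappa_gt1 i 0; rewrite iN /= => /andP[i0 i1].
by rewrite gtr0_norm ?subr_gt0//; lra.
Qed.

(** A coded point in the ball lies to the right of [a N], so its first letter is at least [N]; the
    measures of these one-letter cylinders form a geometric series. *)
Lemma ball1_measure_le_tail (r : R) (N : nat) : r <= 1 - a N ->
  (mu (ball (1%R : R) r) <= (C / Z / (1 - omega^-1) * omega ^- N.+1)%:E)%E.
Proof.
move=> rN.
have sub : coding @^-1` ball (1 : R) r `<=`
    \bigcup_k (cylinder [:: (k + N)%N] : set shift_space).
  move=> i; rewrite /= -ball_normE /= => ir; exists (i 0%N - N)%N => //.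
  have := coding_spec _ kappa_gt1 i 0; rewrite PS_E /= => /andP[_ i0].
  have Ni : (N <= i 0%N)%N.
    rewrite -ltnS ltnNge; apply/negP => /(a_homo_le _ kappa_gt1) iN.
    by move: ir; rewrite ltr_norml => /andP[_]; lra.
  by case=> [|//] _ /=; rewrite subnK.
have omega1 : `|omega^-1| < 1 by rewrite gtr0_norm ?invr_gt0// invf_lt1.
apply: le_trans (measure_sigma_subadditive nu _ _ sub) _.
- by move=> k; exact: measurable_cylinder.
- by apply: measurable_coding_open => //; exact: ball_open.
have g := @cvg_geometric_series _ (C / Z * omega ^- N.+1) _ omega1.
rewrite [X in (X <= _)%E](_ : _ =
    (C / Z * omega ^- N.+1 / (1 - omega^-1))%:E); last first.
  have E (n : nat) : (\sum_(0 <= k < n) nu (cylinder [:: (k + N)%N]))%E =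
      (series (geometric (C / Z * omega ^- N.+1) omega^-1) n)%:E.
    rewrite /series /= -sumEFin; apply: eq_bigr => k _.
    rewrite nu_cylinder big_seq1 -addnS exprD exprVn; congr _%:E.
    by field; rewrite !expf_neq0 ?gt_eqF.
  apply/cvg_lim => //; apply: cvg_EFin.
    by apply: nearW => n; rewrite E.
  by apply: cvg_trans g; apply: near_eq_cvg; apply: nearW => n /=; rewrite E.
by rewrite lee_fin mulrAC.
Qed.

(* The centre 1 is where the branches accumulate: the ball meets only the
   cylinders of first letter at least of order [r ^ - sigma]. *)
Lemma ball1_measure_le : exists2 d, 0 < d & \forall r \near (0 : R)^'+,
  (mu (ball (1%R : R) r) <= (expR (- (d * (r `^ sigma)^-1)))%:E)%E.
Proof.
set K := (zeta_kappa kappa * 2 `^ kappa)^-1.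
have c0 : 0 < zeta_kappa kappa by exact: lt_trans (zeta_kappa_gt1 _ kappa_gt1).
have K0 : 0 < K by rewrite invr_gt0 mulr_gt0// powR_gt0.
set E := C / Z / (1 - omega^-1).
have E0 : 0 < E by rewrite !divr_gt0// subr_gt0 invf_lt1.
(* The bound [1 <= V] makes [truncn V] positive; the other bound gives [ln E <= ln omega / 2 * V],
   so that the factor [E] costs at most half of the exponent. *)
pose A := Num.max 1 (2 * ln E / ln omega).
have A1 : 1 <= A by rewrite le_max lexx.
have A0 : 0 < A by exact: lt_le_trans A1.
exists (ln omega / 2 * K `^ sigma); first by rewrite !mulr_gt0 ?powR_gt0.
near=> r; have r0 : 0 < r by [].
have Ar : A <= (K / r) `^ sigma.
  rewrite le_powR_sigma ?divr_ge0 ?(ltW A0) ?(ltW K0) ?(ltW r0)//.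
  rewrite ler_pdivlMr// mulrC -ler_pdivlMr ?powR_gt0//.
  by near: r; apply: nbhs_right_le; rewrite divr_gt0 ?powR_gt0.
set V := (K / r) `^ sigma in Ar.
have V0 : 0 <= V by exact: powR_ge0.
have N0 : (0 < Num.truncn V)%N by rewrite truncn_gt0; exact: le_trans Ar.
have NV : (Num.truncn V)%:R <= V by rewrite truncn_le.
apply: le_trans (ball1_measure_le_tail _ _ (radius_le_a_tail _ kappa_gt1 _ _ N0 r0 NV)) _.
have VE : V = K `^ sigma * (r `^ sigma)^-1.
  apply: (canRL (mulfK _)); first by rewrite gt_eqF// powR_gt0.
  by rewrite -powRM ?divfK ?gt_eqF ?divr_ge0// ltW.
rewrite lee_fin -/E -[_ / r `^ _]mulrA -VE exp_omega -[X in X * expR _](lnK E0) -expRD ler_expR.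
have NV1 : ln omega * V <= ln omega * (Num.truncn V).+1%:R.
  by rewrite ler_pM2l// ltW// truncnS_gt.
have : 2 * ln E / ln omega <= V by apply: le_trans Ar; rewrite le_max lexx orbT.
rewrite ler_pdivrMr//; by lra.
Unshelve. all: by end_near. Qed.

(** The lower bound is uniform over the support; the upper one comes from the ball about 1 alone. *)
Lemma M_bounds : exists d D, [/\ 0 < d, 0 < D & \forall r \near (0 : R)^'+,
  expR (- (D * (r `^ sigma)^-1)) <= M mu r <= expR (- (d * (r `^ sigma)^-1))].
Proof.
have [D D0 DM] := ball_measure_ge; have [d d0 dM] := ball1_measure_le.
exists d, D; split => //; near=> r; have r0 : 0 < r by [].
have r1 : r <= 1 by near: r; exact: nbhs_right_le.
have lb : ((expR (- (D * (r `^ sigma)^-1)))%:E <=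
    ereal_inf [set mu (ball x r) | x in msupp mu])%E.
  by apply: le_ereal_inf_tmp => _ [x sx <-]; exact: DM.
have ub : (ereal_inf [set mu (ball x r) | x in msupp mu] <=
    (expR (- (d * (r `^ sigma)^-1)))%:E)%E.
  apply: (@le_trans _ _ (mu (ball (1 : R) r))); last by near: r.
  by apply: ereal_inf_lbound; exists 1 => //; exact: one_in_msupp.
(* The bounds exclude an infinite infimum, on which [fine] would take its default value 0. *)
rewrite /M; move: lb ub; case: (ereal_inf _) => [x|//|//].
by rewrite !lee_fin => -> ->.
Unshelve. all: by end_near. Qed.

End bernoulli_image.

Theorem proposition3p1 (R : realType) (kappa omega : R)
    (nu : {finite_measure set shift_space -> \bar R}) :
  1 < kappa -> 1 < omega -> finite_bernoulli omega nu ->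
  upper_minkowski_dim (pushforward nu (coding kappa)) = +oo%E /\
  has_stretched_minkowski_dim (pushforward nu (coding kappa))
    ((kappa - 1)^-1)%:E.
Proof.
move=> kappa_gt1 omega_gt1 [C [Z [C0 Z0 nuE]]].
have s0 : 0 < (kappa - 1)^-1 by rewrite invr_gt0 subr_gt0.
have [d [D [d0 D0 dD]]] := M_bounds _ _ _ _ _ kappa_gt1 omega_gt1 C0 Z0 nuE.
split; first exact: (limf_esup_ln_ratio _ _ _ _ s0 d0 dD).
exact: (limf_stretched_ratio _ _ _ _ d0 D0 dD).
Qed.
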